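(* Let $k,l$ be positive integers and let $C$ be a strongly cancellative set on $D_l^k$. Then $$|C|\le (2l)^{k/2}+\frac{k(l-1)}{2}+1.$$
   Context: $D_l^k$ is the lattice formed by the product of $k$ chains of length $l-1$ (each having $l$ elements): its points are the integer vectors $(v_1,\ldots,v_k)$ with $0\le v_i\le l-1$ for all $i$, ordered by $v\preceq w$ if and only if $v_i\le w_i$ for all $1\le i\le k$. Thus $\wedge$ and $\vee$ are the componentwise minimum and maximum, respectively. A strongly cancellative set of (or on) a lattice $L$ is a subset $C$ of the points of $L$ such that for any three different points $a_1,a_2,a_3\in C$, $a_1\wedge a_2\neq a_1\wedge a_3$ and $a_1\vee a_2\neq a_1\vee a_3$. *)

(* Defs.v *)
From HB Require Import structures.
From mathcomp Require Import all_boot all_order all_algebra.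
From mathcomp Require Import reals exp.

Set Implicit Arguments.
Unset Strict Implicit.
Unset Printing Implicit Defensive.

Import Order.TTheory GRing.Theory Num.Theory.

Local Open Scope order_scope.

(* D_l^k: [k.-tupleprod T] is [k.-tuple T] carrying the product order, so <=   *)
(* is componentwise and `&`, `|` are the componentwise min and max (leEtprod,  *)
(* tnth_meet, tnth_join).                                                      *)
Notation chain_prod l k := (k.-tupleprod 'I_l).

Definition strongly_cancellative (d : Order.disp_t) (L : latticeType d)
    (C : {pred L}) : Prop :=
  forall a1 a2 a3 : L, a1 \in C -> a2 \in C -> a3 \in C ->
    a1 <> a2 -> a1 <> a3 -> a2 <> a3 ->
    a1 `&` a2 <> a1 `&` a3 /\ a1 `|` a2 <> a1 `|` a3.

(* Main.v *)
Require Import Defs.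
From mathcomp Require Import all_boot all_order all_algebra.
From mathcomp Require Import reals exp.
From mathcomp Require Import lra.
Import Order.TTheory GRing.Theory Num.Theory.
Local Open Scope ring_scope.

(** Fix a point [a] of [C].  The set [B] of the other points of [C] has at
    most (2l)^(k/2) elements, for the following reason.

    Strong cancellativity says that both b |-> a /\ b and b |-> a \/ b are
    injective on [B].  So if Q and Q' are nonnegative weights of total mass at
    most 1 on the whole lattice, then the sum over b in [B] of
    (Q (a /\ b) + Q' (a \/ b)) / 2 is at most 1 ([sum_prod_weight_le1]).  It
    therefore suffices to find such weights with
    Q (a /\ b) * Q' (a \/ b) >= (2l)^(-k) for every b, because by the
    inequality of arithmetic and geometric means each term of that sum is then
    at least (2l)^(-k/2).

    Product weights reduce this to one coordinate: for x in a chain of l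
    elements, weights [meet_weight] and [join_weight] of mass at most 1 with
    meet_weight (min x y) * join_weight (max x y) >= 1/(2l) for all y
    ([meet_join_weight_ge]).  The same bound is suggested by entropy: for a
    random y, the entropies of min x y and max x y add up to the entropy of y,
    at most log l, plus the mutual information of the events y < x and
    y > x, at most log 2.  The two explicit weights achieve this bound
    whatever the law of y is. *)

Section ChainWeights.
Variable R : realFieldType.

(** Both weights below are constant on either side of the threshold [x], so
    they are given in the common form that makes their masses computable. *)
Definition threshold_fun (x : nat) (below at_x above : R) (u : nat) : R :=
  if (u < x)%N then below else if u == x then at_x else above.

Lemma sum_threshold_fun l (x : 'I_l) (c1 c2 c3 : R) :
  \sum_(u < l) threshold_fun x c1 c2 c3 u =
    c1 *+ x + c2 + c3 *+ (l - x.+1).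
Proof.
rewrite -(big_mkord xpredT (threshold_fun x c1 c2 c3)).
rewrite (big_cat_nat (n := x)) ?(ltnW (ltn_ord x)) //= [X in _ + X]big_ltn //.
rewrite addrA; congr (_ + _ + _).
- rewrite (eq_big_nat _ _ (F2 := fun=> c1)); first by rewrite sumr_const_nat subn0.
  by move=> u /andP[_ ux]; rewrite /threshold_fun ux.
- by rewrite /threshold_fun ltnn eqxx.
- rewrite (eq_big_nat _ _ (F2 := fun=> c3)); first by rewrite sumr_const_nat.
  by move=> u /andP[xu _]; rewrite /threshold_fun ltnNge (ltnW xu) gtn_eqF.
Qed.

(** Half of the mass sits at [x], the value of [min x y] for all [y >= x]; the
    other half is spread evenly below [x].  For [x = 0] there is nothing below,
    and the total mass is 1/2. *)
Definition meet_weight (x : nat) : nat -> R :=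
  threshold_fun x (2 * x%:R)^-1 2^-1 0.

(** The law of [max x y] for [y] uniform on the chain of [l] elements. *)
Definition join_weight (l x : nat) : nat -> R :=
  threshold_fun x 0 (x.+1%:R / l%:R) l%:R^-1.

Lemma meet_weight_ge0 x u : 0 <= meet_weight x u.
Proof.
by rewrite /meet_weight /threshold_fun; do 2?case: ifP => _ //;
  rewrite invr_ge0 ?mulr_ge0.
Qed.

Lemma join_weight_ge0 l x u : 0 <= join_weight l x u.
Proof.
by rewrite /join_weight /threshold_fun; do 2?case: ifP => _ //;
  rewrite ?divr_ge0 ?invr_ge0.
Qed.

Lemma sum_meet_weight_le1 l (x : 'I_l) : \sum_(u < l) meet_weight x u <= 1.
Proof.
rewrite sum_threshold_fun mul0rn addr0.
have [->|x_gt0] := posnP x; first by rewrite mulr0n; lra.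
have x_neq0 : x%:R != 0 :> R by rewrite pnatr_eq0 -lt0n.
by rewrite -[X in X + _]mulr_natr invfM mulfVK //; lra.
Qed.

Lemma sum_join_weight l (x : 'I_l) : \sum_(u < l) join_weight l x u = 1.
Proof.
have l_neq0 : l%:R != 0 :> R by rewrite pnatr_eq0 -lt0n (leq_ltn_trans _ (ltn_ord x)).
rewrite sum_threshold_fun mul0rn add0r -[X in _ + X]mulr_natl -mulrDl -natrD.
by rewrite subnKC ?divff.
Qed.

(** Whichever side of [x] the point [y] lies on, one of the two weights is
    taken at the threshold [x], where it is large enough to make up for the
    small value of the other one. *)
Lemma meet_join_weight_ge l (x y : 'I_l) :
  (2 * l%:R)^-1 <=
    meet_weight x (Order.min x y) * join_weight l x (Order.max x y).
Proof.
have l_gt0 : 0 < l%:R :> R by rewrite ltr0n (leq_ltn_trans _ (ltn_ord x)).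
rewrite /meet_weight /join_weight /threshold_fun.
have [xy|yx|/val_inj <-] := ltngtP x y.
- rewrite min_l ?max_r ?leEord ?(ltnW xy) // ltnn eqxx ltnNge (ltnW xy) /=.
  by rewrite gtn_eqF // invfM.
- rewrite min_r ?max_l ?leEord ?(ltnW yx) // yx ltnn eqxx.
  have x_gt0 : 0 < x%:R :> R by rewrite ltr0n (leq_ltn_trans _ yx).
  rewrite !invfM -mulrA ler_pM2l ?invr_gt0 // mulrA ler_peMl ?invr_ge0 ?(ltW l_gt0) //.
  by rewrite -ler_pdivrMl ?invr_gt0 // invrK mulr1 ler_nat.
- rewrite minxx maxxx ltnn eqxx invfM ler_pM2l ?invr_gt0 //.
  by rewrite ler_peMl ?invr_ge0 ?(ltW l_gt0) // ler1n.
Qed.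

End ChainWeights.

(** An injective image of [A] in a product carries at most the total mass,
    and the mass of a product weight factors over the coordinates. *)
Lemma sum_prod_weight_le1 (R : realFieldType) (T : finType) (A : {set T})
    (k l : nat) (f : T -> k.-tuple 'I_l) (w : 'I_k -> 'I_l -> R) :
  {in A &, injective f} ->
  (forall i u, 0 <= w i u) -> (forall i, \sum_u w i u <= 1) ->
  \sum_(b in A) \prod_i w i (tnth (f b) i) <= 1.
Proof.
move=> f_inj w_ge0 w_le1.
pose g b := [ffun i => tnth (f b) i].
have g_inj : {in A &, injective g}.
  move=> b1 b2 b1A b2A /ffunP eq_g; apply: f_inj => //.
  by apply: eq_from_tnth => i; have := eq_g i; rewrite !ffunE.
pose W (v : {ffun 'I_k -> 'I_l}) := \prod_i w i (v i).
rewrite (eq_bigr (W \o g)); last first.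
  by move=> b _; apply: eq_bigr => i _; rewrite ffunE.
rewrite /= -(big_imset W g_inj) /=.
apply: (@le_trans _ _ (\sum_v W v)).
  rewrite [leRHS](bigID (mem (g @: A))) /= lerDl.
  by apply: sumr_ge0 => v _; apply: prodr_ge0.
rewrite -(bigA_distr_bigA w).
by apply: prodr_ile1 => i _; rewrite sumr_ge0 /=.
Qed.

(** By the inequality of arithmetic and geometric means, every element of [A]
    contributes at least [M^-1] to the sum of [(P b + Q b) / 2], which is at
    most 1. *)
Lemma card_le_of_prod_weights (R : realFieldType) (T : finType) (A : {set T})
    (M : R) (P Q : T -> R) :
  0 < M -> (forall b, 0 <= P b) -> (forall b, 0 <= Q b) ->
  (forall b, (M ^+ 2)^-1 <= P b * Q b) ->
  \sum_(b in A) P b <= 1 -> \sum_(b in A) Q b <= 1 -> #|A|%:R <= M.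
Proof.
move=> M_gt0 P_ge0 Q_ge0 PQ_ge sumP sumQ.
have avg_ge b : M^-1 <= (P b + Q b) / 2.
  rewrite -ler_sqr ?nnegrE ?invr_ge0 ?divr_ge0 ?addr_ge0 ?(ltW M_gt0) // exprVn.
  by apply: (le_trans (PQ_ge b)); have := sqr_ge0 (P b - Q b); nra.
rewrite -[leRHS]mul1r -ler_pdivrMr // mulr_natl -sumr_const.
apply: (le_trans (ler_sum _ (fun b _ => avg_ge b))).
by rewrite -mulr_suml big_split /=; lra.
Qed.

Theorem theorem5p4 (R : realType) (k l : nat) (hk : (0 < k)%N) (hl : (0 < l)%N)
    (C : {set chain_prod l k}) (hC : strongly_cancellative C) :
  #|C|%:R <= (2 * l%:R) `^ (k%:R / 2) + k%:R * (l%:R - 1) / 2 + 1 :> R.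
Proof.
set M := _ `^ _.
have M_gt0 : 0 < M by rewrite powR_gt0 // mulr_gt0 // ltr0n.
have mid_ge0 : 0 <= k%:R * (l%:R - 1) / 2 :> R.
  by rewrite divr_ge0 ?mulr_ge0 // subr_ge0 ler1n.
have [->|[a aC]] := set_0Vmem C; first by rewrite cards0; lra.
have cardC : #|C|%:R = 1 + #|C :\ a|%:R :> R by rewrite (cardsD1 a C) aC natrD.
suff: #|C :\ a|%:R <= M by rewrite cardC; lra.
have M2 : M ^+ 2 = (2 * l%:R) ^+ k.
  rewrite -(powR_mulrn 2 (ltW M_gt0)) -powRrM divfK ?pnatr_eq0 //.
  by rewrite powR_mulrn // mulr_ge0.
have inj (op : chain_prod l k -> chain_prod l k) :
    (forall b1 b2, b1 \in C -> b2 \in C -> a <> b1 -> a <> b2 -> b1 <> b2 ->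
       op b1 <> op b2) -> {in C :\ a &, injective op}.
  move=> op_neq b1 b2 /setD1P[/eqP b1a b1C] /setD1P[/eqP b2a b2C] eq_op.
  apply/eqP/negP => /negP/eqP b12.
  by apply: op_neq eq_op => // /esym.
apply: (@card_le_of_prod_weights _ _ _ _
  (fun b => \prod_i meet_weight R (tnth a i) (tnth (a `&` b)%O i))
  (fun b => \prod_i join_weight R l (tnth a i) (tnth (a `|` b)%O i))) => //.
- by move=> b; apply: prodr_ge0 => i _; apply: meet_weight_ge0.
- by move=> b; apply: prodr_ge0 => i _; apply: join_weight_ge0.
- move=> b; rewrite M2 -big_split /= -exprVn -[k in _ ^+ k]card_ord -prodr_const.
  apply: ler_prod => i _; rewrite invr_ge0 mulr_ge0 //=.
  by rewrite tnth_meet tnth_join meetEtotal joinEtotal meet_join_weight_ge.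
- apply: (@sum_prod_weight_le1 _ _ _ _ _ (fun b => (a `&` b)%O)
    (fun i u => meet_weight R (tnth a i) u)) => [|i u|i].
  + by apply: inj => b1 b2 *; apply: (hC _ _ _ _ _ _ _ _ _).1.
  + exact: meet_weight_ge0.
  + exact: sum_meet_weight_le1.
- apply: (@sum_prod_weight_le1 _ _ _ _ _ (fun b => (a `|` b)%O)
    (fun i u => join_weight R l (tnth a i) u)) => [|i u|i].
  + by apply: inj => b1 b2 *; apply: (hC _ _ _ _ _ _ _ _ _).2.
  + exact: join_weight_ge0.
  + by rewrite sum_join_weight.
Qed.
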